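(* Let $p\ge 5$ be a prime and let $r$ be an integer with $1\le r\le p-1$ such that $4r+1$ is a quadratic non-residue modulo $p$. Then for all integers $n\ge 0$ and all integers $k\ge j\ge 0$, \[ a_{p(k-j)+(p-3),\;pk+p}(pn+r)\equiv 0 \pmod p. \]
   Context: For positive integers $r,s$, $a_{r,s}(n)$ denotes the number of multicolored partitions of $n$ in which each even part may appear in one of $r$ colors and each odd part may appear in one of $s$ colors (copies of the same part size in different colors are distinct), with $a_{r,s}(0)=1$. Equivalently, for $|q|<1$, $\sum_{n\ge0}a_{r,s}(n)q^n = f_2^{s-r}/f_1^{s}$, where $f_m=\prod_{i\ge1}(1-q^{mi})$. *)

(* Defs.v *)
From mathcomp Require Import all_boot.

Set Implicit Arguments.
Unset Strict Implicit.
Unset Printing Implicit Defensive.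

(* The coloured copies of the parts 1, ..., n: the index i : 'I_n stands for
   the part i.+1, available in s colours if odd and in r colours if even. *)
Definition colored_part (r s n : nat) : finType :=
  {i : 'I_n & 'I_(if odd i.+1 then s else r)}.

(* A multicoloured partition of n is given by the multiplicities of its
   coloured parts; parts and multiplicities are at most n. *)
Definition colored_partitions (r s n : nat)
    : {set {ffun colored_part r s n -> 'I_n.+1}} :=
  [set m : {ffun colored_part r s n -> 'I_n.+1}
    | \sum_(x : colored_part r s n) (tag x).+1 * m x == n].

Definition a (r s n : nat) : nat := #|colored_partitions r s n|.

Definition quadratic_nonresidue (p c : nat) : Prop :=
  coprime c p /\ ~ exists x : nat, x ^ 2 = c %[mod p].

(* Main.v *)
(* Modulo p, the generating function f_2^(pj+3) / f_1^(p(k+1)) is f_2^3 times a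
   p-th power, that is, times a series in q^p.  By Jacobi's identity
   f_2^3 = sum_m (-1)^m (2m+1) q^(m(m+1)), and m(m+1) = r mod p would make
   4r+1 = (2m+1)^2 a square; hence no exponent congruent to r occurs.

   Jacobi's identity is obtained up to order q^(n+1) from the finite q-binomial
   theorem for prod_(i <= 2n) (q^n - z q^i): the factor i = n vanishes at z = 1,
   so the derivative there is, up to a monomial, (q; q)_n^2.  Series are
   replaced throughout by polynomials compared up to a given order. *)
Require Import Defs.
From mathcomp Require Import all_boot all_algebra.
From mathcomp Require Import zify ring.

Set Implicit Arguments.
Unset Strict Implicit.
Unset Printing Implicit Defensive.

Import GRing.Theory.
Local Open Scope ring_scope.

(** * q-Pochhammer products and Gaussian binomials *)

Definition qpoch (R : comNzRingType) (q : R) (n : nat) : R :=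
  \prod_(i < n) (1 - q ^+ i.+1).

(** The Gaussian binomial coefficient, given by its Pascal rule so that no division occurs and [q]
    may lie in any commutative ring. *)
Fixpoint qbin (R : comNzRingType) (q : R) (n k : nat) {struct n} : R :=
  match n, k with
  | _, 0%N => 1
  | 0%N, _.+1 => 0
  | n'.+1, k'.+1 => qbin q n' k' + q ^+ k * qbin q n' k
  end.

Section QBinomial.

Variables (R : comNzRingType) (q : R).

Lemma qbin0 n : qbin q n 0 = 1.
Proof. by case: n. Qed.

Lemma qbinS n k : qbin q n.+1 k.+1 = qbin q n k + q ^+ k.+1 * qbin q n k.+1.
Proof. by []. Qed.

Lemma qbin_small n k : (n < k)%N -> qbin q n k = 0.
Proof.
elim: n k => [|n IH] [|k] // lt_nk.
by rewrite qbinS !IH ?mulr0 ?addr0 //; lia.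
Qed.

Lemma qpochS n : qpoch q n.+1 = qpoch q n * (1 - q ^+ n.+1).
Proof. by rewrite /qpoch big_ord_recr. Qed.

Lemma qpochD m n :
  qpoch q (m + n) = qpoch q m * \prod_(i < n) (1 - q ^+ (m + i).+1).
Proof. by rewrite /qpoch big_split_ord. Qed.

Lemma qbinn n : qbin q n n = 1.
Proof. by elim: n => // n IH; rewrite qbinS IH qbin_small // mulr0 addr0. Qed.

(** Multiplying the Pascal rule by (q; q)_(k+1) reduces the step to (1 - q^(k+1)) + q^(k+1) (1 -
    q^(n+1)) = 1 - q^(n+k+2). *)
Lemma qbin_qpoch k n :
  qpoch q k * qbin q (k + n) k = \prod_(i < k) (1 - q ^+ (n + i).+1).
Proof.
elim: k n => [|k IHk] n; first by rewrite qbin0 /qpoch !big_ord0 mulr1.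
elim: n => [|n IHn]; first by rewrite addn0 qbinn mulr1.
have shiftE : \prod_(i < k.+1) (1 - q ^+ (n + i).+1)
    = (1 - q ^+ n.+1) * \prod_(i < k) (1 - q ^+ (n.+1 + i).+1).
  rewrite big_ord_recl /= addn0; congr (_ * _); apply: eq_bigr => i _.
  by rewrite /bump add1n addnS addSn.
rewrite addSn qbinS big_ord_recr /= -IHk.
rewrite shiftE -IHk addSnnS in IHn.
rewrite mulrDr [qpoch q k.+1 * (_ * _)]mulrCA IHn qpochS.
rewrite (_ : (n.+1 + k).+1 = k.+1 + n.+1)%N ?exprD; last lia.
by ring.
Qed.

(** The mirror Pascal rule, needed for the symmetry. Induction on both arguments replaces the
    product formula, where (q; q)_k may be a zero divisor. *)
Lemma qbinS_alt k m :
  qbin q (k + m).+1 k.+1 = q ^+ m * qbin q (k + m) k + qbin q (k + m) k.+1.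
Proof.
elim: k m => [|k IHk] m.
  elim: m => [|m IHm]; first by rewrite /= !mulr1 mulr0.
  rewrite !add0n in IHm *.
  by rewrite qbinS [in LHS]IHm qbinS !qbin0 !exprS expr0; ring.
elim: m => [|m IHm].
  by rewrite addn0 qbinS expr0 mul1r (@qbin_small k.+1 k.+2) // mulr0.
have IHk' := IHk m.+1; rewrite addnS -addSn in IHk'.
rewrite addnS qbinS [in LHS]IHk' [in LHS]IHm !(qbinS _ k.+1) (qbinS _ k).
by rewrite !exprS; ring.
Qed.

Lemma qbin_sym k m : qbin q (k + m) k = qbin q (k + m) m.
Proof.
elim: k m => [|k IHk] m; first by rewrite qbin0 qbinn.
elim: m => [|m IHm]; first by rewrite addn0 qbin0 qbinn.
by rewrite addSn qbinS_alt IHk [RHS]qbinS -(addSnnS k m) -IHm; ring.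
Qed.

(** Once the factor i = 0 is split off, the rest is the case n at z q. Keeping y general allows y =
    q^n without negative powers of q. *)
Lemma qbinomial_theorem (y z : R) n :
  \prod_(i < n) (y + z * q ^+ i)
  = \sum_(k < n.+1) q ^+ 'C(k, 2) * qbin q n k * y ^+ (n - k) * z ^+ k.
Proof.
elim: n z => [|n IH] z.
  by rewrite big_ord0 big_ord1 /= !expr0 !mulr1.
rewrite big_ord_recl expr0 mulr1.
under eq_bigr => i _ do rewrite /= /bump /= add1n exprS mulrA.
rewrite IH mulrDl [RHS]big_ord_recl /= subn0 !mulr1 mul1r.
under [X in _ = _ + X]eq_bigr => i _.
  rewrite /bump /= add1n subSS binS bin1 !exprS !mulrDr !mulrDl; over.
rewrite big_split /= [X in _ = _ + (_ + X)]big_ord_recr /= qbin_small ?ltnS //.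
rewrite !(mulr0, mul0r) addr0 addrCA addrC; congr (_ + _).
  rewrite big_ord_recl /= !mulr1 qbin0 !mul1r subn0 mulrDr -exprS.
  congr (_ + _).
  rewrite mulr_sumr; apply: eq_bigr => i _.
  rewrite /bump /= add1n binS bin1 exprMn exprD.
  have -> : (n - i = (n - i.+1).+1)%N by have := ltn_ord i; lia.
  by rewrite !exprS; ring.
rewrite mulr_sumr; apply: eq_bigr => i _.
by rewrite add0n exprMn exprD; ring.
Qed.

End QBinomial.

Lemma rmorph_qbin (R S : comNzRingType) (f : {rmorphism R -> S}) (q : R) n k :
  f (qbin q n k) = qbin (f q) n k.
Proof.
elim: n k => [|n IH] [|k] /=; rewrite ?rmorph0 ?rmorph1 //.
by rewrite rmorphD rmorphM rmorphXn !IH.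
Qed.

(** * The finite form of Jacobi's identity *)

Lemma bin2_double n : ('C(n, 2) + 'C(n, 2) + n = n * n)%N.
Proof. by elim: n => // n IH; rewrite binS bin1; lia. Qed.

Lemma bin2D m n : ('C(m + n, 2) = 'C(m, 2) + 'C(n, 2) + m * n)%N.
Proof.
elim: n => [|n IH]; first by rewrite addn0 muln0 !addn0.
by rewrite addnS !binS !bin1 IH mulnS; lia.
Qed.

(** Here and in [jacobi_exponent_upper]: for y = q^n, the terms k = n - j and k = n + 1 + j carry
    the same power of q, with an offset beyond C(j+1, 2) that is independent of j. *)
Lemma jacobi_exponent_lower n j : (j <= n)%N ->
  ('C(n - j, 2) + n * (n + n.+1 - (n - j))
   = 'C(j.+1, 2) + ('C(n, 2) + n + n * n))%N.
Proof.
move/subnK; move: (n - j)%N => m <-; have := bin2_double j.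
by rewrite (_ : m + j + _ - m = m + j.*2 + 1)%N ?binS ?bin1 ?bin2D; lia.
Qed.

Lemma jacobi_exponent_upper n j : (j <= n)%N ->
  ('C(n.+1 + j, 2) + n * (n + n.+1 - (n.+1 + j))
   = 'C(j.+1, 2) + ('C(n, 2) + n + n * n))%N.
Proof.
move=> le_jn; rewrite addSnnS bin2D.
rewrite (_ : n + n.+1 - (n + j.+1) = n - j)%N; last lia.
by move: (subnK le_jn); move: (n - j)%N => m <-; lia.
Qed.

(** Here and in [prod_subX_upper]: at z = 1, the factors on either side of the vanishing one i =
    n. *)
Lemma prod_subX_lower (R : comNzRingType) (q : R) n :
  \prod_(i < n) (q ^+ n - q ^+ i) = (-1) ^+ n * q ^+ 'C(n, 2) * qpoch q n.
Proof.
have -> : qpoch q n = \prod_(i < n) (1 - q ^+ (n - i)).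
  rewrite /qpoch (reindex_inj rev_ord_inj); apply: eq_bigr => i _ /=.
  by rewrite -subSn // subSS.
have -> : (-1) ^+ n = \prod_(i < n) (-1 : R).
  by rewrite prodr_const card_ord.
rewrite -bin2_sum big_mkord -prodrXr -!big_split.
apply: eq_bigr => i _ /=.
by rewrite mulN1r mulNr mulrBr mulr1 -exprD subnKC ?opprB // ltnW.
Qed.

Lemma prod_subX_upper (R : comNzRingType) (q : R) n :
  \prod_(i < n) (q ^+ n - q ^+ (n.+1 + i)) = q ^+ (n * n) * qpoch q n.
Proof.
have -> : q ^+ (n * n) = \prod_(i < n) q ^+ n.
  by rewrite prodr_const card_ord exprM.
rewrite -big_split; apply: eq_bigr => i _ /=.
by rewrite mulrBr mulr1 -exprD addSnnS.
Qed.

Lemma finite_jacobi (R : idomainType) (q : R) n : q != 0 ->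
  \sum_(j < n.+1) (-1) ^+ j * j.*2.+1%:R * q ^+ 'C(j.+1, 2)
                  * qbin q (n + n.+1) (n - j)
  = qpoch q n ^+ 2.
Proof.
move=> q_neq0; pose T := ('C(n, 2) + n + n * n)%N.
(* This monomial is what the derivative at 1 produces besides (q; q)_n^2; it can be cancelled in an
   integral domain. *)
have qT_neq0 : (-1) ^+ n.+1 * q ^+ T != 0.
  by rewrite mulf_neq0 ?expf_neq0 ?oppr_eq0 ?oner_eq0.
apply: (mulfI qT_neq0).
(* The factor i = n is q^n (1 - X); [K] is the product without 1 - X, so the derivative at 1 is -
   K(1). *)
pose K : {poly R} := q%:P ^+ n * \prod_(i < n) (q%:P ^+ n - 'X * q%:P ^+ i)
   * \prod_(i < n) (q%:P ^+ n - 'X * q%:P ^+ (n.+1 + i)).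
have prodE : \prod_(i < n + n.+1) (q%:P ^+ n + - 'X * q%:P ^+ i) = (1 - 'X) * K.
  rewrite big_split_ord big_ord_recl /= addn0 /K.
  under eq_bigr => i _ do rewrite mulNr.
  under [X in _ * (_ * X)]eq_bigr => i _.
    rewrite mulNr /bump /= add1n addnS -addSn; over.
  ring.
have := congr1 (fun f : {poly R} => (f^`()).[1])
  (qbinomial_theorem q%:P (q%:P ^+ n) (- 'X) (n + n.+1)).
rewrite prodE => eq_deriv.
have lhsE : (((1 - 'X) * K)^`()).[1] = (-1) ^+ n.+1 * q ^+ T * qpoch q n ^+ 2.
  have -> : ((1 - 'X) * K)^`() = - K + (1 - 'X) * K^`().
    by rewrite derivM derivB derivX -polyC1 derivC sub0r polyC1 mulN1r.
  rewrite hornerD hornerN [((1 - 'X) * _).[1]]hornerM hornerD hornerN hornerX.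
  rewrite -polyC1 hornerC subrr mul0r addr0 /K !hornerM !horner_prod.
  under eq_bigr => i _ do rewrite !hornerE.
  under [X in _ * X]eq_bigr => i _ do rewrite !hornerE.
  rewrite horner_exp hornerC prod_subX_lower prod_subX_upper /T exprS !exprD.
  ring.
rewrite -lhsE eq_deriv raddf_sum horner_sum.
(* The 2n + 2 terms are paired as k = n - j and k = n + 1 + j. Both have the same power of q and the
   same Gaussian binomial but opposite signs, so the weights k from the derivative leave their
   difference 2j + 1. *)
rewrite (_ : (n + n.+1).+1 = n.+1 + n.+1)%N // big_split_ord /=.
rewrite [X in _ = X + _](reindex_inj rev_ord_inj) -big_split mulr_sumr.
apply: eq_bigr => j _ /=.
have le_jn : (j <= n)%N by rewrite -ltnS.
have summandE k e : ('C(k, 2) + n * (n + n.+1 - k))%N = e ->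
   ((q%:P ^+ 'C(k, 2) * qbin q%:P (n + n.+1) k
     * q%:P ^+ n ^+ (n + n.+1 - k) * (- 'X) ^+ k)^`()).[1]
   = q ^+ e * qbin q (n + n.+1) k * (-1) ^+ k * k%:R.
  move=> <-; rewrite -!(rmorph_qbin (polyC : {rmorphism R -> {poly R}})).
  rewrite [(- 'X) ^+ k]exprNn -(polyCN 1) -!rmorphXn /= !mulrA.
  rewrite -!rmorphM /= mul_polyC derivZ derivXn hornerZ.
  rewrite hornerMn hornerXn expr1n.
  by rewrite exprD exprM; ring.
rewrite subSS (summandE _ ('C(j.+1, 2) + T)%N); last first.
  exact: jacobi_exponent_lower.
rewrite (summandE _ ('C(j.+1, 2) + T)%N); last first.
  exact: jacobi_exponent_upper.
have -> : qbin q (n + n.+1) (n.+1 + j) = qbin q (n + n.+1) (n - j).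
  by rewrite (_ : n + n.+1 = (n - j) + (n.+1 + j))%N ?qbin_sym //; lia.
have -> : (-1) ^+ (n.+1 + j) = (-1) ^+ n.+1 * (-1) ^+ j :> R by rewrite exprD.
have -> : (-1) ^+ (n - j) = - ((-1) ^+ n.+1 * (-1) ^+ j) :> R.
  rewrite -exprD -signr_odd -[in RHS]signr_odd oddB // oddD /=.
  by case: odd; case: odd; rewrite ?expr0 ?expr1 ?opprK.
have -> : (n.+1 + j)%:R = (n - j)%:R + j.*2.+1%:R :> R.
  by rewrite -natrD; congr _%:R; lia.
by rewrite exprD; ring.
Qed.

(** * Polynomials compared up to a given order *)

Definition eq_upto (R : nzRingType) (m : nat) (f g : {poly R}) : Prop :=
  forall i, (i < m)%N -> f`_i = g`_i.

Section Truncation.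

Variable R : comNzRingType.
Implicit Types f g h : {poly R}.

Lemma eq_upto_trans m g f h : eq_upto m f g -> eq_upto m g h -> eq_upto m f h.
Proof. by move=> fg gh i lt_im; rewrite fg ?gh. Qed.

Lemma eq_upto_leq m n f g : (n <= m)%N -> eq_upto m f g -> eq_upto n f g.
Proof. by move=> le_nm fg i lt_in; apply: fg; apply: leq_trans le_nm. Qed.

Lemma eq_uptoM m f1 g1 f2 g2 :
  eq_upto m f1 g1 -> eq_upto m f2 g2 -> eq_upto m (f1 * f2) (g1 * g2).
Proof.
move=> fg1 fg2 i lt_im; rewrite !coefM; apply: eq_bigr => j _.
by rewrite fg1 ?fg2 //; have := ltn_ord j; lia.
Qed.

Lemma eq_uptoX m f g e : eq_upto m f g -> eq_upto m (f ^+ e) (g ^+ e).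
Proof.
move=> fg; elim: e => [|e IH]; first by rewrite !expr0.
by rewrite !exprS; apply: eq_uptoM.
Qed.

Lemma eq_upto_sum (I : finType) m (F G : I -> {poly R}) :
  (forall i, eq_upto m (F i) (G i)) -> eq_upto m (\sum_i F i) (\sum_i G i).
Proof.
by move=> FG l lt_lm; rewrite !coef_sum; apply: eq_bigr => i _; apply: FG.
Qed.

Lemma eq_upto_prod (I : finType) m (F G : I -> {poly R}) :
  (forall i, eq_upto m (F i) (G i)) -> eq_upto m (\prod_i F i) (\prod_i G i).
Proof.
move=> FG; elim/big_rec2: _ => // i f g _ fg; exact: eq_uptoM.
Qed.

Lemma eq_upto_XnM m d f g :
  eq_upto m f g -> eq_upto (d + m) ('X^d * f) ('X^d * g).
Proof.
move=> fg i lt_i; rewrite !coefXnM; case: ltnP => // le_di.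
by apply: fg; lia.
Qed.

Lemma eq_upto_subXn m d f : (m <= d)%N -> eq_upto m (f - 'X^d) f.
Proof.
by move=> le_md i lt_im; rewrite coefB coefXn ltn_eqF ?subr0 //; lia.
Qed.

Lemma eq_upto_prod_1subXn m n (d : 'I_n -> nat) : (forall i, m <= d i)%N ->
  eq_upto m (\prod_i (1 - 'X^(d i)) : {poly R}) 1.
Proof.
move=> le_md; elim/big_ind: _ => // [f g f1 g1|i _]; last exact: eq_upto_subXn.
by rewrite -[X in eq_upto _ _ X]mulr1; apply: eq_uptoM.
Qed.

Lemma eq_upto_compXn m d f g : (0 < d)%N ->
  eq_upto m f g -> eq_upto (d * m) (f \Po 'X^d) (g \Po 'X^d).
Proof.
move=> d_gt0 fg i lt_i; rewrite !coef_comp_poly_Xn //; case: ifP => // _.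
by apply: fg; rewrite ltn_divLR // mulnC.
Qed.

End Truncation.

(** * Jacobi's identity up to a given order *)

Lemma qpochX_qbin (R : comNzRingType) n j : (j <= n)%N ->
  eq_upto (n - j).+1
    (qpoch ('X : {poly R}) n * qbin 'X (n + n.+1) (n - j)) 1.
Proof.
move=> le_jn.
(* Both the last j factors of (q; q)_n and the product of (q; q)_(n-j) with the Gaussian binomial
   consist of factors 1 - X^d with d > n - j. *)
rewrite -[X in qpoch _ X](subnK le_jn) qpochD mulrAC.
rewrite (_ : n + n.+1 = n - j + (n.+1 + j))%N ?qbin_qpoch; last lia.
rewrite -[X in eq_upto _ _ X]mulr1; apply: eq_uptoM.
  by apply: eq_upto_prod_1subXn => i; lia.
by apply: eq_upto_prod_1subXn => i; lia.
Qed.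

Theorem jacobi (R : idomainType) n :
  eq_upto n.+1 (qpoch ('X : {poly R}) n ^+ 3)
    (\sum_(j < n.+1) (-1) ^+ j * j.*2.+1%:R * 'X^('C(j.+1, 2))).
Proof.
rewrite exprS -finite_jacobi ?polyX_eq0 // mulr_sumr.
apply: eq_upto_sum => j.
have := @qpochX_qbin R n j (ltn_ord j).
move/(@eq_upto_XnM _ _ 'C(j.+1, 2)); rewrite mulr1 => eqj.
(* The factor X^C(j+1, 2) makes up for the j missing orders, as C(j+1, 2) >= j. *)
have le_n : (n < 'C(j.+1, 2) + (n - j).+1)%N.
  by rewrite binS bin1; have := ltn_ord j; lia.
have {}eqj := eq_uptoM (f1 := (-1) ^+ j * j.*2.+1%:R) (fun _ _ => erefl)
  (eq_upto_leq le_n eqj).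
by apply: eq_upto_trans eqj => i _; congr (polyseq _)`_i; ring.
Qed.

(** * The generating function of [a] *)

Definition trunc_geom (R : nzRingType) (n d : nat) : {poly R} :=
  \sum_(m < n.+1) 'X^(d * m).

Lemma trunc_geomE (R : comNzRingType) n d : (0 < d)%N ->
  eq_upto n.+1 (trunc_geom R n d * (1 - 'X^d)) 1.
Proof.
move=> d_gt0.
have -> : trunc_geom R n d * (1 - 'X^d) = 1 - 'X^(d * n.+1).
  rewrite exprM -{2}(expr1n _ n.+1) subrXX mulrC; congr (_ * _).
  by apply: eq_bigr => i _; rewrite expr1n mul1r exprM.
by apply: eq_upto_subXn; nia.
Qed.

(** Expanding the product over coloured parts chooses one multiplicity per part; as both sides bound
    multiplicities by n, the terms are exactly the multiplicity functions. *)
Lemma a_genfun (R : comNzRingType) r s n :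
  (a r s n)%:R
  = (\prod_(i < n) trunc_geom R n i.+1 ^+ (if odd i.+1 then s else r))`_n.
Proof.
have -> : \prod_(i < n) trunc_geom R n i.+1 ^+ (if odd i.+1 then s else r)
    = \prod_(x : colored_part r s n) \sum_(m < n.+1) 'X^((tag x).+1 * m).
  rewrite -(sig_big_dep xpredT (fun _ => xpredT)
    (fun (i : 'I_n) (_ : 'I_(if odd i.+1 then s else r)) =>
       trunc_geom R n i.+1)) /=.
  by apply: eq_bigr => i _; rewrite prodr_const card_ord.
rewrite bigA_distr_bigA /= coef_sum /a -sum1_card natr_sum big_mkcond /=.
apply: eq_bigr => m _; rewrite prodrXr coefXn inE eq_sym.
by case: eqP.
Qed.

(** * Reduction modulo p *)

Lemma coef_exp_pchar (R : comNzRingType) p (f : {poly R}) i :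
  p \in [pchar R] -> ~~ (p %| i)%N -> (f ^+ p)`_i = 0.
Proof.
move=> pcharR ndvd; have pcharRX : p \in [pchar {poly R}] by rewrite pchar_poly.
(* Frobenius is additive, so f^p is the sum of the p-th powers of the monomials of f. *)
rewrite -(pFrobenius_autE pcharRX) -[f]coefK poly_def rmorph_sum.
rewrite coef_sum big1 // => j _.
rewrite /= pFrobenius_autE exprZn coefZ -exprM coefXn.
by case: eqP ndvd => [->|]; rewrite ?dvdn_mull ?mulr0.
Qed.

Lemma prod_even_qpoch (R : comNzRingType) n :
  \prod_(i < n) (if odd i.+1 then 1 else 1 - 'X^(i.+1))
  = qpoch ('X : {poly R}) n./2 \Po 'X^2.
Proof.
elim: n => [|n IH]; first by rewrite /qpoch !big_ord0 comp_polyC.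
rewrite big_ord_recr IH /= uphalf_half; case: (boolP (odd n)) => odd_n.
  rewrite add1n qpochS rmorphM rmorphB /= rmorphXn /= comp_polyX.
  rewrite -polyC1 comp_polyC.
  by rewrite -exprM (_ : 2 * _ = n.+1)%N //; have := odd_double_half n; lia.
by rewrite add0n mulr1.
Qed.

Lemma dvdn_a_nonsquare p r n k j : prime p -> (3 <= p)%N -> (j <= k)%N ->
    ~ (exists x : nat, x ^ 2 = 4 * r + 1 %[mod p])%N ->
  (p %| a (p * (k - j) + (p - 3)) (p * k + p) (p * n + r))%N.
Proof.
move=> p_prime p_ge3 le_jk nonsquare; set N := (p * n + r)%N.
have pcharF : p \in [pchar 'F_p] := pchar_Fp p_prime.
rewrite (dvdn_pcharf pcharF) a_genfun.
set s := (p * k + p)%N; set r' := (_ + (p - 3))%N.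
(* [H] truncates f_2^j / f_1^(k+1), and [E] truncates f_2. *)
pose H :=
  \prod_(i < N) trunc_geom 'F_p N i.+1
    ^+ (if odd i.+1 then k.+1 else (k - j).+1).
pose E := \prod_(i < N) (if odd i.+1 then 1 else 1 - 'X^(i.+1) : {poly 'F_p}).
have step1 : eq_upto N.+1
    (\prod_(i < N) trunc_geom 'F_p N i.+1 ^+ (if odd i.+1 then s else r'))
    (H ^+ p * E ^+ 3).
  rewrite -!prodrXl -big_split; apply: eq_upto_prod => i /=.
  rewrite -exprM; set g := trunc_geom _ _ _.
  case: ifP => _.
    by rewrite expr1n mulr1 (_ : s = k.+1 * p)%N // /s; lia.
  (* At each even part the p-th power has three geometric series too many; the cube of 1 - X^(i+1)
     cancels them modulo X^(N+1). *)
  rewrite (_ : (k - j).+1 * p = r' + 3)%N; last by rewrite /r'; lia.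
  rewrite exprD -mulrA -exprMn -[X in eq_upto _ X _]mulr1.
  apply: eq_uptoM => //; rewrite -[X in eq_upto _ X _](expr1n _ 3).
  apply: eq_uptoX => l lt_l.
  by rewrite /g trunc_geomE.
have step2 : eq_upto N.+1 (E ^+ 3)
    (\sum_(m < (N./2).+1) (-1) ^+ m * m.*2.+1%:R * 'X^(m * m.+1)).
  rewrite /E prod_even_qpoch -rmorphXn /=.
  (* Substituting X^2 doubles the order N/2 + 1, which then covers N + 1, and turns the exponent
     C(m+1, 2) into m(m+1). *)
  have /(eq_upto_compXn (isT : (0 < 2)%N)) := @jacobi 'F_p N./2.
  move/(@eq_upto_leq _ _ N.+1) => /(_ _)/eq_upto_trans; apply; first lia.
  move=> i _; congr (polyseq _)`_i.
  rewrite raddf_sum; apply: eq_bigr => m _ /=.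
  rewrite !rmorphM /= !rmorphXn /= rmorphN1 rmorph_nat comp_polyX -exprM.
  congr (_ * 'X^_); have := bin2_double m; rewrite binS bin1; lia.
rewrite step1 // coefM big1 // => i _.
have [p_dvd_i|/(coef_exp_pchar _ pcharF) ->] := boolP (p %| i)%N;
  last by rewrite mul0r.
rewrite step2 ?coef_sum ?big1 ?mulr0 //; last by rewrite ltnS leq_subr.
move=> m _.
have -> : (-1) ^+ m * m.*2.+1%:R = ((-1) ^+ m * m.*2.+1%:R)%:P :> {poly 'F_p}.
  by rewrite rmorphM rmorphXn rmorphN1 rmorph_nat.
rewrite coefCM coefXn; case: eqP => [eq_m|_]; last by rewrite mulr0.
(* A surviving term has p | i and m(m+1) = N - i, hence (2m+1)^2 = 4(N - i) + 1, which is 4r + 1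
   modulo p. Below, i = c p is moved to the other side to avoid the subtraction. *)
case: nonsquare; exists m.*2.+1.
case/dvdnP: p_dvd_i eq_m => c iE.
have := ltn_ord i; rewrite iE /N ltnS => /subnK + eq_m; rewrite {}eq_m.
move: (nat_of_ord m) => {}m eq_m.
apply/eqP; rewrite -(eqn_modDr (4 * (c * p))%N).
have -> : (m.*2.+1 ^ 2 + 4 * (c * p) = 4 * n * p + (4 * r + 1))%N.
  by rewrite -mulnn -mul2n; lia.
by rewrite modnMDl mulnA [(_ + _ * p)%N]addnC modnMDl.
Qed.

Local Close Scope ring_scope.

Theorem theorem1p13 (p r : nat) (p_prime : prime p) (p_ge5 : 5 <= p)
    (r_bounds : 1 <= r <= p - 1)
    (r_nonres : quadratic_nonresidue p (4 * r + 1)) :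
  forall n k j : nat, j <= k ->
    a (p * (k - j) + (p - 3)) (p * k + p) (p * n + r) = 0 %[mod p].
Proof.
move=> n k j le_jk; have [_ nonsquare] := r_nonres.
apply/eqP; rewrite mod0n; apply: dvdn_a_nonsquare => //.
exact: leq_trans p_ge5.
Qed.
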